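(* Let $\mathfrak g$ be a $\mathbb Z$-graded quadratic color Lie algebra with form $B$, let $\psi_{\mathrm{KP}}$ be its Kac--Peterson cocycle and let $\Psi_{\mathrm{KP}}$ be the endomorphism of $\mathfrak g$ determined by $\psi_{\mathrm{KP}}(x,y)=B(\Psi_{\mathrm{KP}}(x),y)$ for all $x,y\in\mathfrak g$. Then: (a) $\Psi_{\mathrm{KP}}$ preserves the $\mathbb Z\times\Gamma$-grading of $\mathfrak g$. (b) For $\rho\in(\mathfrak g^* )_{(0,0_\Gamma)}$ one has $\psi_{\mathrm{KP}}=\mathrm d\rho$ if and only if $\Psi_{\mathrm{KP}}=[\rho^\sharp,\cdot\,]$.
   Context: Fix an abelian group $\Gamma$ (additive, neutral element $0_\Gamma$) and a commutation factor $\varepsilon:\Gamma\times\Gamma\to\mathbb C^\times$, i.e. $\varepsilon$ is multiplicative in each variable and $\varepsilon(\alpha,\beta)\varepsilon(\beta,\alpha)=1$. For homogeneous $x,y$ of degrees $|x|,|y|\in\Gamma$ write $\varepsilon(x,y)=\varepsilon(|x|,|y|)$, $\varepsilon(x)=\varepsilon(x,x)$. A color Lie algebra is a $\Gamma$-graded complex vector space with a $\Gamma$-graded bilinear bracket with $[x,y]=-\varepsilon(x,y)[y,x]$ and $[x,[y,z]]=[[x,y],z]+\varepsilon(x,y)[y,[x,z]]$ for homogeneous elements. $\mathbb Z$-graded quadratic color Lie algebra: a color Lie algebra $\mathfrak g=\bigoplus_{i\in\mathbb Z}\mathfrak g_i$ with each $\mathfrak g_i$ a finite-dimensional $\Gamma$-graded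 subspace, $[\mathfrak g_i,\mathfrak g_j]\subseteq\mathfrak g_{i+j}$, and a nondegenerate bilinear form $B$ which is $\varepsilon$-symmetric ($B(x,y)=\varepsilon(x,y)B(y,x)$), invariant ($B([x,y],z)=B(x,[y,z])$) and satisfies $B(x,y)=0$ for bihomogeneous $x,y$ unless $\deg x+\deg y=0$ in $\mathbb Z$ and $|x|+|y|=0_\Gamma$. Put $\mathfrak g_+=\bigoplus_{i>0}\mathfrak g_i$, $\mathfrak g_-=\bigoplus_{i\le0}\mathfrak g_i$, with projections $\pi_\pm:\mathfrak g\to\mathfrak g_\pm$. $\mathfrak g^*$ is the restricted dual (direct sum of duals of the $\mathfrak g_i$), graded by $(\mathfrak g^* )_{(i,\gamma)}=(\mathfrak g_{(-i,-\gamma)})^*$; for $\rho\in\mathfrak g^*$, $\rho^\sharp\in\mathfrak g$ is defined by $B(\rho^\sharp,y)=\rho(y)$; $\mathrm d\rho(x,y)=\rho([x,y])$. The $\varepsilon$-trace of a finite-rank (finitary) endomorphism is $\operatorname{tr}_\varepsilon(T)=\sum_a\varepsilon(e_a)B(T(e_a),e^a)$ for a homogeneous basis $(e_a)$ with $B$-dual basis $(e^a)$, $B(e_a,e^b)=\delta_{ab}$. The Kac--Peterson cocycle is, for homogeneous $x,y$, $\psi_{\mathrm{KP}}(x,y)=\tfrac12\operatorname{tr}_\varepsilon(\mathrm{ad}_x\pi_-\mathrm{ad}_y\pi_+)-\tfrac12\varepsilon(x,y)\operatorname{tr}_\varepsilon(\mathrm{ad}_y\pi_-\mathrm{ad}_x\pi_+)$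 (well defined since $\pi_-\mathrm{ad}_x\pi_+$ has finite rank). *)

(* Defs.v *)
From mathcomp Require Import all_boot all_order all_algebra.
From mathcomp Require Import boolp classical_sets functions cardinality fsbigop.

Set Implicit Arguments.
Unset Strict Implicit.
Unset Printing Implicit Defensive.

Import Order.TTheory GRing.Theory Num.Theory.

Local Open Scope classical_set_scope.
Local Open Scope ring_scope.

Definition subspace (K : fieldType) (V : lmodType K) (W : set V) : Prop :=
  W 0 /\ forall (c : K) (x y : V), W x -> W y -> W (c *: x + y).

Definition decomposition (K : fieldType) (V : lmodType K) (D : choiceType)
    (V_ : D -> set V) (x : V) (f : D -> V) : Prop :=
  [/\ finite_set [set d | f d != 0],
      forall d, V_ d (f d) &
      x = \sum_(d \in [set: D]) f d].

(* V is the (internal) direct sum of the subspaces V_ d. *)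
Definition grading (K : fieldType) (V : lmodType K) (D : choiceType)
    (V_ : D -> set V) : Prop :=
  (forall d, subspace (V_ d)) /\
  (forall x, exists! f, decomposition V_ x f).

(* The default value 0 is never used when V_ is a grading. *)
Definition component (K : fieldType) (V : lmodType K) (D : choiceType)
    (V_ : D -> set V) (d : D) (x : V) : V :=
  xget 0 [set y | exists2 f, decomposition V_ x f & y = f d].

Definition finite_dimensional (K : fieldType) (V : lmodType K)
    (W : set V) : Prop :=
  exists (n : nat) (b : 'I_n -> V), (forall i, W (b i)) /\
    forall x, W x -> exists c : 'I_n -> K, x = \sum_i c i *: b i.

Definition basis (K : fieldType) (V : lmodType K) (I : choiceType)
    (e : I -> V) : Prop :=
  forall x, exists! c : I -> K,
    finite_set [set i | c i != 0] /\ x = \sum_(i \in [set: I]) c i *: e i.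

Record commutation_factor (K : fieldType) (G : zmodType) := CommutationFactor {
  cfactor :> G -> G -> K;
  cfactor_neq0 : forall a b, cfactor a b != 0;
  cfactorDl : forall a b c, cfactor (a + b) c = cfactor a c * cfactor b c;
  cfactorDr : forall a b c, cfactor a (b + c) = cfactor a b * cfactor a c;
  cfactorC : forall a b, cfactor a b * cfactor b a = 1
}.

Record colorLie (K : fieldType) (G : zmodType)
    (eps : commutation_factor K G) := ColorLie {
  colorLie_space :> lmodType K;
  ghom : G -> set colorLie_space;
  ghom_grading : grading ghom;
  brk : {bilinear colorLie_space -> colorLie_space -> colorLie_space};
  brk_ghom : forall a b x y, ghom a x -> ghom b y -> ghom (a + b) (brk x y);
  brk_skew : forall a b x y, ghom a x -> ghom b y ->
    brk x y = - (eps a b *: brk y x);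
  brk_jacobi : forall a b c x y z, ghom a x -> ghom b y -> ghom c z ->
    brk x (brk y z) = brk (brk x y) z + eps a b *: brk y (brk x z)
}.

Arguments ghom {K G eps} _ _ _.
Arguments brk {K G eps _}.

Record zquadColorLie (K : fieldType) (G : zmodType)
    (eps : commutation_factor K G) := ZquadColorLie {
  zquad_colorLie :> colorLie eps;
  zhom : int -> set zquad_colorLie;
  zhom_grading : grading zhom;
  zhom_findim : forall i, finite_dimensional (zhom i);
  zhom_graded : forall i x, zhom i x ->
    forall a, zhom i (component (ghom zquad_colorLie) a x);
  brk_zhom : forall i j x y, zhom i x -> zhom j y -> zhom (i + j) (brk x y);
  qform : {biscalar zquad_colorLie};
  qform_nondeg : (forall x, (forall y, qform x y = 0) -> x = 0) /\
                 (forall y, (forall x, qform x y = 0) -> y = 0);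
  qform_sym : forall a b x y, ghom _ a x -> ghom _ b y ->
    qform x y = eps a b * qform y x;
  qform_inv : forall x y z, qform (brk x y) z = qform x (brk y z);
  qform_deg : forall i j a b x y,
    zhom i x -> ghom _ a x -> zhom j y -> ghom _ b y ->
    ~ (i + j = 0 /\ a + b = 0) -> qform x y = 0
}.

Arguments zhom {K G eps} _ _ _.
Arguments qform {K G eps _}.

Section KacPeterson.
Context (K : fieldType) (G : zmodType) (eps : commutation_factor K G).
Context (g : zquadColorLie eps).
Implicit Types (x y z : g) (rho : {scalar g}) (T : g -> g).

Definition proj_plus x : g :=
  \sum_(i \in [set i : int | 0 < i]) component (zhom g) i x.

Definition proj_minus x : g :=
  \sum_(i \in [set i : int | i <= 0]) component (zhom g) i x.

(* deg records the bidegree of each basis vector. *)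
Definition dual_homogeneous_bases (I : choiceType) (deg : I -> int * G)
    (e e' : I -> g) : Prop :=
  [/\ basis e,
      forall a, zhom g (deg a).1 (e a) /\ ghom g (deg a).2 (e a) &
      forall a b, qform (e a) (e' b) = (a == b)%:R].

(* For T of finite rank only finitely many summands are nonzero and the sum is
   the same for all dual homogeneous bases; the value is picked among them. *)
Definition eps_trace T : K :=
  xget 0 [set t | exists (I : choiceType) (deg : I -> int * G) (e e' : I -> g),
    dual_homogeneous_bases deg e e' /\
    t = \sum_(a \in [set: I])
          eps (deg a).2 (deg a).2 * qform (T (e a)) (e' a)].

(* The value on x and y homogeneous of G-degrees a and b. *)
Definition psiKP_hom (a b : G) x y : K :=
  2^-1 * eps_trace (fun z => brk x (proj_minus (brk y (proj_plus z)))) -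
  2^-1 * eps a b *
    eps_trace (fun z => brk y (proj_minus (brk x (proj_plus z)))).

(* Extends psiKP_hom biadditively: eps is only given on degrees. *)
Definition psiKP x y : K :=
  \sum_(a \in [set: G]) \sum_(b \in [set: G])
    psiKP_hom a b (component (ghom g) a x)
                  (component (ghom g) b y).

Definition is_PsiKP (Psi : g -> g) : Prop :=
  linear Psi /\ forall x y, psiKP x y = qform (Psi x) y.

Definition preserves_bigrading (Psi : g -> g) : Prop :=
  forall i a x, zhom g i x -> ghom g a x -> zhom g i (Psi x) /\ ghom g a (Psi x).

(* Membership in the direct sum of the duals of the zhom i. *)
Definition restricted_dual rho : Prop :=
  exists2 A : set int, finite_set A &
    forall i x, ~ A i -> zhom g i x -> rho x = 0.

(* rho lies in the dual of the component of bidegree (- i, - a), extended by 0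
   on the other components. *)
Definition dual_degree (i : int) (a : G) rho : Prop :=
  restricted_dual rho /\
  forall j b x, zhom g j x -> ghom g b x -> (j, b) <> (- i, - a) -> rho x = 0.

(* For rho in the restricted dual such a z exists and is unique. *)
Definition sharp rho : g := xget 0 [set z | forall y, qform z y = rho y].

Definition dform rho x y : K := rho (brk x y).

End KacPeterson.

(* Main.v *)
(* Everything reduces to the bilinear form [psiKP] having total degree zero.
   The trace of a finite-rank operator [sum_k B(t_k, .) v_k], computed in any
   pair of dual homogeneous bases, equals [sum_k B(t_k, S v_k)], where [S]
   multiplies the component of degree [a] by [eps a a]. Hence the trace is
   independent of the bases and linear on finite-rank operators, and [psiKP] is
   bilinear. An operator shifting one of the two gradings by a nonzero degree
   has no diagonal coefficients, so [psiKP x y = 0] unless the degrees of [x] and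
   [y] add up to zero. For fixed [x], [psiKP x] is therefore supported on
   finitely many of the finite-dimensional pieces, and nondegeneracy of the form
   represents it by a unique vector [Psi x]. *)
Require Import Defs.
From mathcomp Require Import all_boot all_order all_algebra.
From mathcomp Require Import boolp classical_sets functions cardinality fsbigop.
From mathcomp Require Import finmap zify ring reals complex.

Set Implicit Arguments.
Unset Strict Implicit.
Unset Printing Implicit Defensive.

Import Order.TTheory GRing.Theory Num.Theory.

Local Open Scope classical_set_scope.
Local Open Scope ring_scope.

(** * Maps known only through the predicates [linear] and [scalar] *)

Section LinearFunctions.
Context (K : fieldType) (V W : lmodType K).

Lemma linear_fun0 (f : V -> W) : linear f -> f 0 = 0.
Proof. by move=> fP; have := fP (-1) 0 0; rewrite scaler0 addr0 scaleN1r addNr. Qed.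

Lemma linear_funD (f : V -> W) : linear f -> {morph f : x y / x + y}.
Proof. by move=> fP x y; have := fP 1 x y; rewrite !scale1r. Qed.

Lemma linear_funZ (f : V -> W) (c : K) x : linear f -> f (c *: x) = c *: f x.
Proof. by move=> fP; have := fP c x 0; rewrite linear_fun0// !addr0. Qed.

Lemma scalar_fun0 (f : V -> K) : scalar f -> f 0 = 0.
Proof. by move=> fP; have := fP (-1) 0 0; rewrite scaler0 addr0 mulN1r addNr. Qed.

Lemma scalar_funD (f : V -> K) : scalar f -> {morph f : x y / x + y}.
Proof. by move=> fP x y; have := fP 1 x y; rewrite scale1r mul1r. Qed.

End LinearFunctions.

(** * Sums of finite support over arbitrary index sets *)

Section FiniteSupport.
Context (I : choiceType).

(** The support may be enlarged to any convenient finite [S], which lets several sums be compared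
    over one common list. *)
Lemma fsumE (V : zmodType) (A S : set I) (F : I -> V) :
    finite_set S -> S `<=` A -> (forall i, A i -> ~ S i -> F i = 0) ->
  \sum_(i \in A) F i = \sum_(i <- fset_set S) F i.
Proof.
move=> finS SA F0; rewrite -fsbig_finite//; apply/esym/fsbig_widen => //.
by move=> i [] /F0; apply.
Qed.

Lemma fsum_morph (V W : zmodType) (f : V -> W) (A : set I) (F : I -> V) :
    {morph f : x y / x + y} -> finite_set [set i | F i != 0] ->
  f (\sum_(i \in A) F i) = \sum_(i \in A) f (F i).
Proof.
move=> fD finF; have f0 : f 0 = 0.
  by apply: (addrI (f 0)); rewrite -fD !addr0.
have F0 i : A i -> ~ (A `&` [set i | F i != 0]) i -> F i = 0.
  by move=> Ai /not_andP[]// /negP/negPn/eqP.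
have finS : finite_set (A `&` [set i | F i != 0]) by exact: finite_setIr.
rewrite !(@fsumE _ A (A `&` [set i | F i != 0]))//.
  exact: (big_morph f fD f0).
by move=> i Ai Si; rewrite (F0 _ Ai Si).
Qed.

Lemma fsumD (V : zmodType) (A : set I) (F G : I -> V) :
    finite_set [set i | F i != 0] -> finite_set [set i | G i != 0] ->
  \sum_(i \in A) (F i + G i) = \sum_(i \in A) F i + \sum_(i \in A) G i.
Proof.
move=> finF finG.
pose S := A `&` ([set i | F i != 0] `|` [set i | G i != 0]).
have finS : finite_set S by apply: finite_setIr; rewrite finite_setU.
have S0 i : A i -> ~ S i -> F i = 0 /\ G i = 0.
  move=> Ai /not_andP[]// /not_orP[].
  by move=> /negP/negPn/eqP -> /negP/negPn/eqP ->.
have SA : S `<=` A by move=> i [].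
rewrite !(@fsumE _ A S)//; first exact: big_split.
- by move=> i Ai Si; case: (S0 i Ai Si).
- by move=> i Ai Si; case: (S0 i Ai Si).
- by move=> i Ai Si; case: (S0 i Ai Si) => -> ->; rewrite addr0.
Qed.

Lemma fsum_single (V : zmodType) (A : set I) (F : I -> V) (j : I) :
  (forall i, i != j -> F i = 0) -> \sum_(i \in A) F i = if j \in A then F j else 0.
Proof.
move=> F0; case: ifPn => [|/negP] jA; last first.
  by rewrite fsbig1// => i Ai; apply: F0; apply: contra_not_neq jA => <-; exact/mem_set.
rewrite (@fsumE _ A [set j])//; first by rewrite fset_set1 big_seq_fset1.
- by move=> _ ->; apply/set_mem.
- by move=> i _ ij; apply: F0; apply/eqP.
Qed.

End FiniteSupport.

(** * Components with respect to one grading *)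

Section Gradings.
Context (K : fieldType) (V : lmodType K) (D : choiceType) (V_ : D -> set V).
Hypothesis gradV : grading V_.

Local Notation "x `_[ d ]" := (component V_ d x) (at level 3, format "x `_[ d ]").

Lemma homP d (c : K) x y : V_ d x -> V_ d y -> V_ d (c *: x + y).
Proof. by case: gradV => /(_ d)[_ h] _; apply: h. Qed.

Lemma hom0 d : V_ d 0.
Proof. by case: gradV => /(_ d)[]. Qed.

Lemma homD d x y : V_ d x -> V_ d y -> V_ d (x + y).
Proof. by move=> *; rewrite -[x]scale1r; apply: homP. Qed.

(** Decompositions are unique, so the choice made by [component] is harmless and components are
    computed by exhibiting any decomposition. *)
Lemma component_unique x f : decomposition V_ x f -> (component V_)^~ x = f.
Proof.
move=> xf; apply/funext => d; rewrite /component; case: xgetP => [y _|].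
  move=> [f' xf' ->]; case: gradV => _ /(_ x)[f0 [_ u]].
  by rewrite -(u _ xf) -(u _ xf').
by move/(_ (f d)) => h; exfalso; apply: h; exists f.
Qed.

Lemma component_decomposition x : decomposition V_ x ((component V_)^~ x).
Proof.
by case: gradV => _ /(_ x)[f [xf _]]; rewrite (component_unique xf).
Qed.

Lemma component_hom d x : V_ d x`_[d].
Proof. by case: (component_decomposition x). Qed.

Lemma component_finite x : finite_set [set d | x`_[d] != 0].
Proof. by case: (component_decomposition x). Qed.

Lemma component_sum x : x = \sum_(d \in [set: D]) x`_[d].
Proof. by case: (component_decomposition x). Qed.

Lemma component_id d d' x : V_ d x -> x`_[d'] = if d' == d then x else 0.
Proof.
move=> xd; rewrite -[LHS]/((component V_)^~ x d').
rewrite (@component_unique x (fun k => if k == d then x else 0))//; split.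
- apply: (@sub_finite_set _ _ [set d]) => // k /=.
  by case: (eqVneq k d) => //; rewrite eqxx.
- by move=> k; case: eqVneq => [->//|_]; exact: hom0.
- rewrite (@fsum_single _ _ _ _ d) ?in_setT ?eqxx// => k /negPf ->//.
Qed.

Lemma component_stable d d' x : V_ d x -> V_ d x`_[d'].
Proof.
by move=> xd; rewrite (component_id _ xd); case: eqP => // _; exact: hom0.
Qed.

Lemma componentP d : linear (component V_ d).
Proof.
move=> c x y; rewrite -[LHS]/((component V_)^~ (c *: x + y) d).
rewrite (@component_unique _ (fun k => c *: x`_[k] + y`_[k]))//; split.
- apply: (@sub_finite_set _ _ ([set d | x`_[d] != 0] `|` [set d | y`_[d] != 0])).
    move=> k /=; have [->|? _] := eqVneq (x`_[k]) 0; last by left.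
    by rewrite scaler0 add0r; right.
  by rewrite finite_setU; split; exact: component_finite.
- by move=> k; apply: homP; exact: component_hom.
- rewrite fsumD; last exact: component_finite.
    rewrite -(@fsum_morph _ _ _ ( *:%R c)) -?component_sum//.
      exact: scalerDr.
    exact: component_finite.
  apply: sub_finite_set (component_finite x) => k /=.
  by apply: contra_neq => ->; rewrite scaler0.
Qed.

Lemma componentD d : {morph component V_ d : x y / x + y}.
Proof. exact/linear_funD/componentP. Qed.

Lemma componentZ d c x : (c *: x)`_[d] = c *: x`_[d].
Proof. exact/linear_funZ/componentP. Qed.

Lemma component0 d : 0`_[d] = 0.
Proof. exact/linear_fun0/componentP. Qed.

Lemma hom_fsum (I : choiceType) d (A : set I) (F : I -> V) :
  (forall k, V_ d (F k)) -> V_ d (\sum_(k \in A) F k).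
Proof.
by move=> VF; apply: big_ind => //; [exact: hom0|exact: homD].
Qed.

(** Takes the place of a basis argument: additive statements are checked on homogeneous vectors
    only. *)
Lemma grading_ind (P : V -> Prop) :
  P 0 -> (forall x y, P x -> P y -> P (x + y)) ->
  (forall d x, V_ d x -> P x) -> forall x, P x.
Proof.
move=> P0 PD Phom x; rewrite [x]component_sum.
by apply: big_ind => // d _; apply: Phom (component_hom d x).
Qed.

(** Common source of the linearity of [proj_plus], [proj_minus], [twist] and the sums defining
    [psiKP]. *)
Lemma components_linear (W : lmodType K) (A : set D) (h : D -> V -> W) :
  (forall d, linear (h d)) -> linear (fun x => \sum_(d \in A) h d x`_[d]).
Proof.
move=> hP c x y.
have h0 d : h d 0 = 0 by exact: linear_fun0.
have finh z : finite_set [set d | h d z`_[d] != 0].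
  apply: sub_finite_set (component_finite z) => k /=.
  by apply: contra_neq => ->.
transitivity (\sum_(d \in A) (c *: h d x`_[d] + h d y`_[d])).
  by apply: eq_fsbigr => d _; rewrite componentP hP.
rewrite fsumD//; last first.
  apply: sub_finite_set (finh x) => k /=.
  by apply: contra_neq => ->; rewrite scaler0.
by rewrite -(@fsum_morph _ _ _ ( *:%R c))//; exact: scalerDr.
Qed.

End Gradings.

(** * Two compatible gradings *)

Section CommutingGradings.
Context (K : fieldType) (V : lmodType K) (D E : choiceType).
Context (V_ : D -> set V) (W_ : E -> set V).
Hypotheses (gradV : grading V_) (gradW : grading W_).
Hypothesis VW : forall d x, V_ d x -> forall e, V_ d (component W_ e x).

Lemma component_commute d e x :
  component W_ e (component V_ d x) = component V_ d (component W_ e x).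
Proof.
elim/(grading_ind gradV): x => [|x y hx hy|d' x xd'].
- by rewrite !(component0 gradV, component0 gradW).
- by rewrite !(componentD gradV, componentD gradW) hx hy.
- rewrite (component_id gradV _ xd') (component_id gradV _ (VW xd' e)).
  by case: eqP => // _; rewrite component0.
Qed.

Lemma component_hom_swap d e x : W_ e x -> W_ e (component V_ d x).
Proof.
(* This form lets [component_id] be read backwards: [x] becomes its own [e]-component, and the two
   projections commute. *)
move=> xe; rewrite -[x in component V_ d x]/(if true then x else 0) -(eqxx e).
rewrite -(component_id gradW _ xe) -component_commute.
exact: component_hom.
Qed.

End CommutingGradings.

(** * Nondegeneracy of the form and finite-rank operators *)

Section KacPetersonTheory.
Context (K : fieldType) (G : zmodType) (eps : commutation_factor K G).
Context (g : zquadColorLie eps).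
Implicit Types (x y z t v : g) (T : g -> g).

Local Notation gradZ := (zhom_grading g).
Local Notation gradG := (ghom_grading g).

Lemma qform_injl x y : (forall z, qform x z = qform y z) -> x = y.
Proof.
move=> xy; apply/subr0_eq; case: (qform_nondeg g) => nd _; apply: nd => z.
by rewrite linearBl xy subrr.
Qed.

(* Only functionals represented by the form are allowed. *)
Inductive finite_rank : (g -> g) -> Prop :=
| finite_rank0 : finite_rank (fun=> 0)
| finite_rankS t v T : finite_rank T ->
    finite_rank (fun x => qform t x *: v + T x).

Lemma finite_rank_linear T : finite_rank T -> linear T.
Proof.
elim=> [|t v {}T _ IH] c x y; first by rewrite scaler0 addr0.
by rewrite IH linearPr scalerDl scalerDr scalerA addrACA.
Qed.

Lemma finite_rankD T T' :
  finite_rank T -> finite_rank T' -> finite_rank (fun x => T x + T' x).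
Proof.
move=> + frT'; elim=> [|t v {}T _ IH].
  by under eq_fun do rewrite add0r.
by under eq_fun do rewrite -addrA; constructor.
Qed.

Lemma finite_rank_comp (L : g -> g) T :
  linear L -> finite_rank T -> finite_rank (fun x => L (T x)).
Proof.
move=> LP; elim=> [|t v {}T _ IH].
  by under eq_fun do rewrite (linear_fun0 LP); constructor.
by under eq_fun do rewrite LP; constructor.
Qed.

(** If [T] is the sum of the [qform t_k x *: v_k], then [t] is the sum of the [f v_k *: t_k]. *)
Lemma riesz_finite_rank (f : g -> K) T :
  scalar f -> finite_rank T -> exists t, forall x, qform t x = f (T x).
Proof.
move=> fP; elim=> [|t v {}T _ [t' IH]].
  by exists 0 => x; rewrite linear0l scalar_fun0.
exists (f v *: t + t') => x.
by rewrite linearPl IH fP mulrC.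
Qed.

(** Vectors are added one at a time: if [T] does not yet fix [w], nondegeneracy supplies a
    functional detecting the error [w - T w]. *)
Lemma span_finite_rank (s : seq g) :
  exists2 T, finite_rank T & forall v, v \in s -> T v = v.
Proof.
elim: s => [|w s [T frT Ts]]; first by exists (fun=> 0) => //; constructor.
have TP := finite_rank_linear frT.
have [Tw|/eqP wTw] := eqVneq (w - T w) 0.
  exists T => // v; rewrite inE => /orP[/eqP->|/Ts//].
  by apply/esym/subr0_eq.
have [t tw] : exists t, qform t (w - T w) = 1.
  have [t /eqP t0] : exists t, qform t (w - T w) <> 0.
    apply: contrapT => /forallNP h; apply: wTw.
    by apply: (qform_nondeg g).2 => x; apply: contrapT; apply: h.
  exists ((qform t (w - T w))^-1 *: t).
  by rewrite linearZl_LR /= mulVf.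
(* The difference [t - t'] will represent [x |-> B(t, x - T x)], which vanishes on the vectors
   already fixed and is [1] at [w]. *)
have [t' t'T] : exists t', forall x, qform t' x = qform t (T x).
  by apply: riesz_finite_rank => // c x y; rewrite linearPr.
(* [T] corrected by the rank-one operator [x |-> B(t, x - T x) (w - T w)]. *)
exists (fun x => qform (t - t') x *: (w - T w) + T x); first by constructor.
have tE x : qform (t - t') x = qform t (x - T x).
  by rewrite linearBl linearBr t'T.
move=> v; rewrite tE inE => /orP[/eqP->|/Ts ->].
  by rewrite tw scale1r subrK.
by rewrite subrr linear0r scale0r add0r.
Qed.

(** * Orthogonality of homogeneous pieces and representation of functionals *)

Lemma qform_zhom i j x y :
  zhom g i x -> zhom g j y -> i + j != 0 -> qform x y = 0.
Proof.
move=> xi yj ij; rewrite [x](component_sum gradG) [y](component_sum gradG).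
rewrite linear_sumlz big1// => a _; rewrite linear_sumr big1// => b _.
apply: (@qform_deg _ _ _ g i j a b); do ?exact: zhom_graded.
- exact: (component_hom gradG).
- exact: (component_hom gradG).
- by case=> /eqP; rewrite (negbTE ij).
Qed.

(** Mirror image of [zhom_graded], obtained because the two families of projections commute. *)
Lemma ghom_graded a x i : ghom g a x -> ghom g a (component (zhom g) i x).
Proof.
by apply: (component_hom_swap gradZ gradG) => d y; apply: zhom_graded.
Qed.

Lemma qform_ghom a b x y :
  ghom g a x -> ghom g b y -> a + b != 0 -> qform x y = 0.
Proof.
move=> xa yb ab; rewrite [x](component_sum gradZ) [y](component_sum gradZ).
rewrite linear_sumlz big1// => i _; rewrite linear_sumr big1// => j _.
apply: (@qform_deg _ _ _ g i j a b); do ?exact: ghom_graded.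
- exact: (component_hom gradZ).
- exact: (component_hom gradZ).
- by case=> _ /eqP; rewrite (negbTE ab).
Qed.

Section OrthogonalGrading.
Context (D : zmodType) (V_ : D -> set g).
Hypothesis gradV : grading V_.
Hypothesis qform_orth : forall d d' x y,
  V_ d x -> V_ d' y -> d + d' != 0 -> qform x y = 0.

(** Only opposite degrees pair nontrivially, so both sides equal the pairing of the [d]-component of
    [x] with the [- d]-component of [y]. *)
Lemma qform_component d x y :
  qform (component V_ d x) y = qform x (component V_ (- d) y).
Proof.
transitivity (qform (component V_ d x) (component V_ (- d) y)).
  elim/(grading_ind gradV): y => [|y z hy hz|d' y yd'].
  - by rewrite component0.
  - by rewrite componentD// !linearDr hy hz.
  - rewrite (component_id gradV _ yd'); case: eqVneq => // dd'.
    rewrite linear0r (qform_orth (component_hom gradV _ _) yd')//.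
    by apply: contra_neq dd' => /eqP; rewrite addrC addr_eq0 => /eqP->.
elim/(grading_ind gradV): x => [|x z hx hz|d' x xd'].
- by rewrite component0// !linear0l.
- by rewrite componentD// !linearDl hx hz.
- rewrite (component_id gradV _ xd'); case: eqVneq => // dd'.
  rewrite linear0l (qform_orth xd' (component_hom gradV _ _))//.
  by rewrite subr_eq0 eq_sym.
Qed.

(** Under this hypothesis [x] and its [d]-component pair identically with homogeneous vectors, hence
    coincide. Vanishing of [psiKP] is turned in this way into homogeneity of [Psi x]. *)
Lemma hom_orthogonal d x :
    (forall d' y, V_ d' y -> d + d' != 0 -> qform x y = 0) -> V_ d x.
Proof.
move=> x0; suff -> : x = component V_ d x by exact: component_hom.
apply: qform_injl; apply: (grading_ind gradV) => [|y z hy hz|d' y yd'].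
- by rewrite !linear0r.
- by rewrite !linearDr hy hz.
- rewrite qform_component (component_id gradV _ yd'); case: eqVneq => // dd'.
  rewrite linear0r (x0 _ _ yd')//.
  by apply: contra_neq dd' => /eqP; rewrite addrC addr_eq0 => /eqP->.
Qed.

End OrthogonalGrading.

(** A finite-rank [T] fixing a spanning family of [zhom g i] leaves the projection unchanged after
    composition. Moving the projection across the form keeps the functionals of the composite
    representable. *)
Lemma component_finite_rank i : finite_rank (component (zhom g) i).
Proof.
have [n [b [_ bspan]]] := zhom_findim g i.
have [T frT Tb] := span_finite_rank (codom b).
have TP := finite_rank_linear frT.
have -> : component (zhom g) i = (fun x => T (component (zhom g) i x)).
  apply/funext => x.
  have [c ->] := bspan _ (component_hom gradZ i x).
  rewrite (big_morph T (linear_funD TP) (linear_fun0 TP)); apply: eq_bigr => k _.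
  by rewrite linear_funZ// Tb// codom_f.
elim: frT => [|t v {T Tb TP} T _ IH]; first by constructor.
have -> : (fun x => qform t (component (zhom g) i x) *: v +
                    T (component (zhom g) i x)) =
          (fun x => qform (component (zhom g) (- i) t) x *: v +
                    T (component (zhom g) i x)).
  by apply/funext => x; rewrite (qform_component gradZ qform_zhom) opprK.
by constructor.
Qed.

Lemma finite_rank_components (s : seq int) (L : g -> g) : linear L ->
  finite_rank (fun x => \sum_(i <- s) L (component (zhom g) i x)).
Proof.
move=> LP; elim: s => [|i s IH].
  by under eq_fun do rewrite big_nil; constructor.
under eq_fun do rewrite big_cons.
apply: finite_rankD => //; apply: finite_rank_comp => //.
exact: component_finite_rank.
Qed.

(** Such an [f] factors through the sum of the projections of degree in [A], which has finite
    rank. *)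
Lemma riesz (f : g -> K) (A : set int) : scalar f -> finite_set A ->
  (forall i x, ~ A i -> zhom g i x -> f x = 0) ->
  exists z, forall x, qform z x = f x.
Proof.
move=> fP finA fA.
have fD := scalar_funD fP.
have [z zE] := riesz_finite_rank fP
  (@finite_rank_components (fset_set A) id (fun _ _ _ => erefl)).
exists z => x; rewrite zE [in RHS](component_sum gradZ x).
rewrite (big_morph f fD (scalar_fun0 fP)) fsum_morph//; last exact: (component_finite gradZ).
rewrite (@fsumE _ _ _ A)// => i _ Ai.
exact: fA Ai (component_hom gradZ i x).
Qed.

(** * The trace in dual homogeneous bases *)

Lemma dual_bases_coord (I : choiceType) (deg : I -> int * G) (e e' : I -> g) x :
  dual_homogeneous_bases deg e e' ->
  finite_set [set a | qform x (e' a) != 0] /\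
  x = \sum_(a \in [set: I]) qform x (e' a) *: e a.
Proof.
case=> /(_ x)[c [[finc xE] _]] _ ee'.
suff cE : (fun a => qform x (e' a)) = c.
  by rewrite (_ : [set a | _] = [set a | c a != 0]) -cE// in finc xE *; split.
apply/funext => a; rewrite [in LHS]xE.
(* Pairing the expansion of [x] with [e' a] leaves only the coefficient at [a]. *)
rewrite (@fsum_morph _ _ _ (fun y => qform y (e' a))).
- rewrite (@fsum_single _ _ _ _ a) ?in_setT => [|b /negPf ba].
    by rewrite linearZl_LR/= ee' eqxx mulr1.
  by rewrite linearZl_LR/= ee' ba mulr0.
- exact: linearDl.
- apply: sub_finite_set finc => b /=.
  by apply: contra_neq => ->; rewrite scale0r.
Qed.

(** The operator [S] of the overview; it absorbs the signs [eps a a] of the trace. *)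
Definition twist : g -> g :=
  fun x => \sum_(a \in [set: G]) eps a a *: component (ghom g) a x.

Lemma twist_linear : linear twist.
Proof.
apply: (@components_linear _ _ _ _ gradG _ _ (fun a x => eps a a *: x)).
by move=> a c x y; rewrite scalerDr !scalerA mulrC.
Qed.

Lemma twist_ghom a x : ghom g a x -> twist x = eps a a *: x.
Proof.
move=> xa; rewrite /twist (@fsum_single _ _ _ _ a) ?in_setT => [|b /negPf ba].
  by rewrite (component_id gradG _ xa) eqxx.
by rewrite (component_id gradG _ xa) ba scaler0.
Qed.

Definition dual_trace (I : choiceType) (deg : I -> int * G) (e e' : I -> g) T
    : K :=
  \sum_(a \in [set: I]) eps (deg a).2 (deg a).2 * qform (T (e a)) (e' a).

Section DualTrace.
Context (I : choiceType) (deg : I -> int * G) (e e' : I -> g).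
Hypothesis dual : dual_homogeneous_bases deg e e'.

Let trace_supp T :=
  [set a | eps (deg a).2 (deg a).2 * qform (T (e a)) (e' a) != 0].

(** Expanding [v] in the basis [e] inside [qform t (twist v)] gives the trace sum term by term. The
    resulting value does not mention the bases. *)
Lemma dual_trace_rank1 t v :
  finite_set (trace_supp (fun x => qform t x *: v)) /\
  dual_trace deg e e' (fun x => qform t x *: v) = qform t (twist v).
Proof.
have [finv vE] := dual_bases_coord v dual; split.
  apply: sub_finite_set finv => a /=; apply: contra_neq => v0.
  by rewrite linearZl_LR/= v0 !mulr0.
have twP := twist_linear.
rewrite [in RHS]vE (@fsum_morph _ _ _ (fun y => qform t (twist y))).
- apply: eq_fsbigr => a _; rewrite linearZl_LR/= linear_funZ//.
  case: dual => _ /(_ a)[_ ea] _; rewrite (twist_ghom ea).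
  by rewrite !linearZr_LR/=; ring.
- by move=> x y; rewrite linear_funD// linearDr.
- apply: sub_finite_set finv => a /=.
  by apply: contra_neq => ->; rewrite scale0r.
Qed.

Lemma dual_trace_finite T : finite_rank T -> finite_set (trace_supp T).
Proof.
elim=> [|t v {}T _ IH].
  apply: (@sub_finite_set _ _ set0) => // a /=.
  by rewrite /trace_supp/= linear0l mulr0 eqxx.
apply: (@sub_finite_set _ _
  (trace_supp (fun x => qform t x *: v) `|` trace_supp T)); last first.
  by rewrite finite_setU; split=> //; case: (dual_trace_rank1 t v).
move=> a; rewrite /trace_supp/= linearDl mulrDr.
have [->|? _] := eqVneq (_ * qform (T (e a)) (e' a)) 0; last by right.
by rewrite addr0; left.
Qed.

Lemma dual_traceD T T' : finite_rank T -> finite_rank T' ->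
  dual_trace deg e e' (fun x => T x + T' x) =
  dual_trace deg e e' T + dual_trace deg e e' T'.
Proof.
move=> /dual_trace_finite finT /dual_trace_finite finT'; rewrite -fsumD//.
by apply: eq_fsbigr => a _; rewrite linearDl mulrDr.
Qed.

Lemma dual_traceZ (c : K) T :
  dual_trace deg e e' (fun x => c *: T x) = c * dual_trace deg e e' T.
Proof.
rewrite /dual_trace mulr_fsumr; apply: eq_fsbigr => a _.
by rewrite linearZl_LR/= mulrCA.
Qed.

End DualTrace.

Lemma dual_trace_unique (I J : choiceType) (deg : I -> int * G) (e e' : I -> g)
    (deg1 : J -> int * G) (f f' : J -> g) T :
  dual_homogeneous_bases deg e e' -> dual_homogeneous_bases deg1 f f' ->
  finite_rank T -> dual_trace deg e e' T = dual_trace deg1 f f' T.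
Proof.
move=> de df; elim=> [|t v {}T frT IH].
  by rewrite /dual_trace !fsbig1// => a _; rewrite linear0l mulr0.
have fr1 : finite_rank (fun x => qform t x *: v).
  by have := finite_rankS t v finite_rank0; under eq_fun do rewrite addr0.
rewrite (dual_traceD de)// (dual_traceD df)// IH.
by rewrite (dual_trace_rank1 de t v).2 (dual_trace_rank1 df t v).2.
Qed.

Lemma eps_trace_dual (I : choiceType) (deg : I -> int * G) (e e' : I -> g) T :
  dual_homogeneous_bases deg e e' -> finite_rank T ->
  eps_trace T = dual_trace deg e e' T.
Proof.
move=> de frT; rewrite /eps_trace; case: xgetP => [t _|].
  by move=> [J [deg1 [f [f' [df ->]]]]]; apply: dual_trace_unique.
by move/(_ (dual_trace deg e e' T)) => h; exfalso; apply: h; exists I, deg, e, e'.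
Qed.

Lemma eps_traceP (c : K) T T' : finite_rank T -> finite_rank T' ->
  eps_trace (fun x => c *: T x + T' x) = c * eps_trace T + eps_trace T'.
Proof.
move=> frT frT'.
(* If some pair of dual bases exists, all three traces are computed in that same pair. *)
have [[I [deg [e [e' de]]]]|nodual] := pselect (exists (I : choiceType)
    (deg : I -> int * G) (e e' : I -> g), dual_homogeneous_bases deg e e').
  have frcT : finite_rank (fun x => c *: T x).
    by apply: (@finite_rank_comp ( *:%R c)) => // b x y; rewrite scalerDr !scalerA mulrC.
  rewrite !(eps_trace_dual de)//; last exact: finite_rankD.
  by rewrite (dual_traceD de)// dual_traceZ.
(* Without dual bases the trace takes its default value. *)
have tr0 T1 : eps_trace T1 = 0.
  rewrite /eps_trace; case: xgetP => // t _ [I [deg [e [e' [de _]]]]].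
  by exfalso; apply: nodual; exists I, deg, e, e'.
by rewrite !tr0 mulr0 addr0.
Qed.

Lemma eps_trace_eq0 T :
  (forall (I : choiceType) (deg : I -> int * G) (e e' : I -> g),
    dual_homogeneous_bases deg e e' -> forall a, qform (T (e a)) (e' a) = 0) ->
  eps_trace T = 0.
Proof.
(* Either the trace takes its default value [0], or it is a sum of vanishing diagonal
   coefficients. *)
move=> T0; rewrite /eps_trace; case: xgetP => // t _ [I [deg [e [e' [de ->]]]]].
by rewrite fsbig1// => a _; rewrite (T0 _ _ _ _ de) mulr0.
Qed.

(** Taking the [d]-component of the expansion of [x] discards every [e b] of degree other than [d],
    in particular [e a]. This is what kills the diagonal of a degree-shifting operator. *)
Lemma dual_coord_shift (I : choiceType) (deg : I -> int * G) (e e' : I -> g)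
    (D : zmodType) (V_ : D -> set g) (dg : I -> D) a d x : grading V_ ->
  dual_homogeneous_bases deg e e' -> (forall b, V_ (dg b) (e b)) ->
  V_ d x -> d != dg a -> qform x (e' a) = 0.
Proof.
move=> gradV de Ve xd da.
have [finx xE] := dual_bases_coord x de.
rewrite -[x](_ : component V_ d x = x); last by rewrite (component_id gradV _ xd) eqxx.
rewrite [in LHS]xE (@fsum_morph _ _ _ (fun y => qform (component V_ d y) (e' a))).
- rewrite fsbig1// => b _; rewrite (componentZ gradV) (component_id gradV _ (Ve b)).
  case: eqVneq => [db|_]; last by rewrite scaler0 linear0l.
  case: de => _ _ ee'; rewrite linearZl_LR/= ee'.
  by rewrite (_ : (b == a) = false) ?mulr0//; apply: contra_neqF da => /eqP <-.
- by move=> y z; rewrite (componentD gradV) linearDl.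
- apply: sub_finite_set finx => b /=.
  by apply: contra_neq => ->; rewrite scale0r.
Qed.

(** * The operators under the Kac-Peterson trace *)

Lemma proj_plus_linear : linear (@proj_plus _ _ _ g).
Proof. exact: (@components_linear _ _ _ _ gradZ _ _ (fun _ x => x)). Qed.

Lemma proj_minus_linear : linear (@proj_minus _ _ _ g).
Proof. exact: (@components_linear _ _ _ _ gradZ _ _ (fun _ x => x)). Qed.

Lemma proj_plus_zhom i x :
  zhom g i x -> proj_plus x = if 0 < i then x else 0.
Proof.
move=> xi; rewrite /proj_plus (@fsum_single _ _ _ _ i) => [|j /negPf ji].
  by rewrite (component_id gradZ _ xi) eqxx mem_setE.
by rewrite (component_id gradZ _ xi) ji.
Qed.

Lemma proj_minus_zhom i x :
  zhom g i x -> proj_minus x = if i <= 0 then x else 0.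
Proof.
move=> xi; rewrite /proj_minus (@fsum_single _ _ _ _ i) => [|j /negPf ji].
  by rewrite (component_id gradZ _ xi) eqxx mem_setE.
by rewrite (component_id gradZ _ xi) ji.
Qed.

Definition adadKP x y z : g := brk x (proj_minus (brk y (proj_plus z))).

Lemma adadKP_linearl y z : linear (fun x : g => adadKP x y z).
Proof. by move=> c x x'; rewrite /adadKP linearPl. Qed.

Lemma adadKP_linearr x z : linear (fun y : g => adadKP x y z).
Proof. by move=> c y y'; rewrite /adadKP linearPl proj_minus_linear linearPr. Qed.

(** Composing with [brk x] keeps the rank finite and the rest is additive in [y], so [y] may be
    taken homogeneous; the operator then factors through finitely many pieces. *)
Lemma adadKP_finite_rank x y : finite_rank (adadKP x y).
Proof.
apply: (@finite_rank_comp (brk x)); first by move=> c u v; rewrite linearPr.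
have MP y' : linear (fun z => proj_minus (brk y' (proj_plus z))).
  by move=> c u v; rewrite proj_plus_linear linearPr proj_minus_linear.
have M0 y' := linear_fun0 (MP y').
have MD y' := linear_funD (MP y').
have pmD := linear_funD proj_minus_linear.
elim/(grading_ind gradZ): y => [|y y' frM frM'|j y yj].
- have -> : (fun z => proj_minus (brk 0 (proj_plus z))) = fun=> 0.
    by apply/funext => z; have := M0 0; rewrite !linear0l.
  by constructor.
- by under eq_fun do rewrite linearDl pmD; apply: (finite_rankD frM frM').
(* Only the degrees [1, ..., -j] contribute: [proj_plus] kills the lower ones,
   and [brk y] sends the higher ones to positive degree. *)
pose s := [seq (Posz k.+1) | k <- iota 0 `|j|%N].
have -> : (fun z => proj_minus (brk y (proj_plus z))) =
    (fun z => \sum_(i <- s)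
       proj_minus (brk y (proj_plus (component (zhom g) i z)))); last first.
  exact: (finite_rank_components s (MP y)).
apply/funext; elim/(grading_ind gradZ) => [|z z' hz hz'|m z zm].
- by rewrite M0 big1// => i _; rewrite (component0 gradZ) M0.
- rewrite MD hz hz' -big_split/=; apply: eq_bigr => i _.
  by rewrite (componentD gradZ) MD.
have us : uniq s by rewrite map_inj_uniq ?iota_uniq// => p q [].
(* For [z] of degree [m] only the term of index [m] can survive, and it occurs at most once in
   [s]. *)
rewrite (eq_bigr (fun i => if i == m then
    proj_minus (brk y (proj_plus z)) else 0)) => [|i _]; last first.
  by rewrite (component_id gradZ _ zm); case: eqP => // _; rewrite M0.
rewrite -big_mkcond/=.
have [ms|ms] := boolP (m \in s).
  rewrite -big_filter (_ : [seq i <- s | i == m] = [:: m]) ?big_seq1//.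
  by rewrite filter_pred1_uniq.
rewrite big_seq_cond big_pred0 => [|i]; last first.
  by apply/negbTE/andP => -[si /eqP im]; rewrite -im si in ms.
rewrite (proj_plus_zhom zm); case: ifP => m0; last first.
  by rewrite linear0r (proj_minus_zhom (hom0 gradZ 0)).
rewrite (proj_minus_zhom (brk_zhom yj zm)); case: ifP => // jm0.
(* Here [0 < m <= - j], so [m] belongs to [s]; the predecessor appears because [s] starts at [1]. *)
case/negP: ms; apply/mapP; exists `|m|.-1%N; last by lia.
by rewrite mem_iota; lia.
Qed.

(** * Bilinearity of [psiKP] *)

Lemma psiKP_homE a b x y :
  psiKP_hom a b x y = 2^-1 * eps_trace (adadKP x y) -
    2^-1 * eps a b * eps_trace (adadKP y x).
Proof. by []. Qed.

Lemma eps_trace_adadl y : scalar (fun x : g => eps_trace (adadKP x y)).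
Proof.
move=> c x x'; rewrite -eps_traceP; try exact: adadKP_finite_rank.
by congr eps_trace; apply/funext => z; rewrite adadKP_linearl.
Qed.

Lemma eps_trace_adadr x : scalar (fun y : g => eps_trace (adadKP x y)).
Proof.
move=> c y y'; rewrite -eps_traceP; try exact: adadKP_finite_rank.
by congr eps_trace; apply/funext => z; rewrite adadKP_linearr.
Qed.

Lemma psiKP_hom_linearl a b y : scalar (fun x : g => psiKP_hom a b x y).
Proof.
move=> c x x'; rewrite !psiKP_homE eps_trace_adadl eps_trace_adadr; ring.
Qed.

Lemma psiKP_hom_linearr a b x : scalar (psiKP_hom a b x).
Proof.
move=> c y y'; rewrite !psiKP_homE eps_trace_adadl eps_trace_adadr; ring.
Qed.

Lemma psiKP_linearr x : scalar (psiKP x).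
Proof.
move=> c y y'; rewrite /psiKP.
(* [K^o] is the field as a module over itself, which brings scalar-valued maps under
   [components_linear]. *)
have inner a := @components_linear _ _ _ _ gradG K^o [set: G]
  (fun b => psiKP_hom a b (component (ghom g) a x))
  (fun b => psiKP_hom_linearr a b _).
have fin0 w : finite_set [set a | \sum_(b \in [set: G])
    psiKP_hom a b (component (ghom g) a x) (component (ghom g) b w) != 0].
  apply: sub_finite_set (component_finite gradG x) => a /=.
  apply: contra_neq => ->; rewrite fsbig1// => b _.
  exact: (scalar_fun0 (psiKP_hom_linearl a b (component (ghom g) b w))).
rewrite mulr_fsumr -fsumD//.
  by apply: eq_fsbigr => a _; exact: inner.
apply: sub_finite_set (fin0 y) => a /=.
by apply: contra_neq => ->; rewrite mulr0.
Qed.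

Lemma psiKP_linearl y : scalar (fun x : g => psiKP x y).
Proof.
(* Now the outer sum is the one running over the components of the variable, and the inner sum has
   its support bounded by the fixed [y]. *)
suff h a : scalar (fun u : g =>
    \sum_(b \in [set: G]) psiKP_hom a b u (component (ghom g) b y)).
  exact: (@components_linear _ _ _ _ gradG K^o [set: G] _ h).
move=> c x x'.
have fin0 w : finite_set [set b | psiKP_hom a b w (component (ghom g) b y) != 0].
  apply: sub_finite_set (component_finite gradG y) => b /=.
  by apply: contra_neq => ->; exact: (scalar_fun0 (psiKP_hom_linearr a b w)).
rewrite mulr_fsumr -fsumD//.
  by apply: eq_fsbigr => b _; exact: psiKP_hom_linearl.
apply: sub_finite_set (fin0 x) => b /=.
by apply: contra_neq => ->; rewrite mulr0.
Qed.

(** * Total degree zero, for an abstract grading later taken to be [zhom] or [ghom] *)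

Section Vanishing.
Context (D : zmodType) (V_ : D -> set g) (dg : int * G -> D).
Hypothesis gradV : grading V_.
Hypothesis brk_hom :
  forall d d' x y, V_ d x -> V_ d' y -> V_ (d + d') (brk x y).
Hypothesis zhomV : forall d x, V_ d x -> forall i, V_ d (component (zhom g) i x).
Hypothesis ghomV : forall d x, V_ d x -> forall a, V_ d (component (ghom g) a x).
Hypothesis bihomV :
  forall i a x, zhom g i x -> ghom g a x -> V_ (dg (i, a)) x.

(** The projections keep the [V_]-degree, so [adadKP x y] shifts it by [d + d'] and has zero
    diagonal. *)
Lemma eps_trace_adad_eq0 d d' x y :
  V_ d x -> V_ d' y -> d + d' != 0 -> eps_trace (adadKP x y) = 0.
Proof.
move=> xd yd' dd'; apply: eps_trace_eq0 => I deg e e' de a.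
have Ve b : V_ (dg (deg b)) (e b).
  by case: de => _ /(_ b)[+ +] _; case: (deg b) => i c; apply: bihomV.
apply: (dual_coord_shift (dg := dg \o deg) (d := d + (d' + dg (deg a))) gradV de Ve).
  rewrite /adadKP /proj_minus /proj_plus.
  apply: brk_hom => //; apply: (hom_fsum gradV) => i; apply: zhomV.
  by apply: brk_hom => //; apply: (hom_fsum gradV) => j; apply: zhomV.
by rewrite addrA -subr_eq0 /= addrK.
Qed.

Lemma psiKP_eq0 d d' x y : V_ d x -> V_ d' y -> d + d' != 0 -> psiKP x y = 0.
Proof.
move=> xd yd' dd'; rewrite /psiKP fsbig1// => a _; rewrite fsbig1// => b _.
have xad := ghomV xd a; have ybd := ghomV yd' b.
rewrite psiKP_homE (eps_trace_adad_eq0 xad ybd)//.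
by rewrite (eps_trace_adad_eq0 ybd xad) ?mulr0 ?subr0// addrC.
Qed.

End Vanishing.

Lemma psiKP_zhom i j x y :
  zhom g i x -> zhom g j y -> i + j != 0 -> psiKP x y = 0.
Proof.
apply: (psiKP_eq0 (dg := fst)) => //; first exact: gradZ.
- by move=> *; apply: brk_zhom.
- by move=> d u ud k; exact: (component_stable gradZ).
- exact: zhom_graded.
Qed.

Lemma psiKP_ghom a b x y :
  ghom g a x -> ghom g b y -> a + b != 0 -> psiKP x y = 0.
Proof.
apply: (psiKP_eq0 (dg := snd)) => //; first exact: gradG.
- by move=> *; apply: brk_ghom.
- by move=> d u ud k; apply: ghom_graded.
- by move=> d u ud c; exact: (component_stable gradG).
Qed.

(** * The endomorphism [Psi], its degree, and the coboundary criterion *)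

Lemma psiKP_riesz x : exists z, forall y, qform z y = psiKP x y.
Proof.
elim/(grading_ind gradZ): x => [|x x' [z zx] [z' zx']|i x xi].
- exists 0 => y; rewrite linear0l.
  exact/esym/(scalar_fun0 (psiKP_linearl y)).
- exists (z + z') => y; rewrite linearDl zx zx'.
  exact/esym/(scalar_funD (psiKP_linearl y)).
(* For [x] of degree [i] the functional [psiKP x] lives on the single piece of degree [- i]. *)
- apply: (@riesz _ [set - i]) => //; first exact: psiKP_linearr.
  move=> j y /eqP ji yj; apply: (psiKP_zhom xi yj).
  by apply: contraNneq ji => /eqP; rewrite addrC addr_eq0.
Qed.

(** Representing vectors are chosen pointwise; their uniqueness turns linearity of [psiKP] in [x]
    into linearity of [Psi]. *)
Lemma PsiKP_exists : exists Psi : g -> g, is_PsiKP Psi.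
Proof.
have [Psi PsiE] := choice psiKP_riesz; exists Psi; split => // c x y.
by apply: qform_injl => z; rewrite linearPl !PsiE psiKP_linearl.
Qed.

(** By [riesz] a representing vector exists, so [sharp] does not fall back on its default. *)
Lemma sharpP (rho : {scalar g}) :
  restricted_dual rho -> forall y, qform (sharp rho) y = rho y.
Proof.
move=> [A finA rhoA].
have [z zE] := riesz (linearP rho) finA rhoA.
by rewrite /sharp; case: xgetP => // /(_ z).
Qed.

Lemma is_PsiKP_bigrading (Psi : g -> g) :
  is_PsiKP Psi -> preserves_bigrading Psi.
Proof.
move=> [_ PsiE] i a x xi xa; split.
- apply: (hom_orthogonal gradZ qform_zhom) => j y yj ij.
  by rewrite -PsiE (psiKP_zhom xi yj).
- apply: (hom_orthogonal gradG qform_ghom) => b y yb ab.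
  by rewrite -PsiE (psiKP_ghom xa yb).
Qed.

(** Invariance turns [rho (brk x y)] into [qform (brk (sharp rho) x) y]; comparison with
    [qform (Psi x) y] and nondegeneracy give both directions. *)
Lemma is_PsiKP_coboundary (Psi : g -> g) (rho : {scalar g}) :
  is_PsiKP Psi -> restricted_dual rho ->
  (forall x y, psiKP x y = dform rho x y) <->
  (forall x, Psi x = brk (sharp rho) x).
Proof.
move=> [_ PsiE] /sharpP rhoE; split=> [psi x|PsiB x y].
  by apply: qform_injl => y; rewrite -PsiE psi /dform -rhoE qform_inv.
by rewrite PsiE PsiB qform_inv rhoE.
Qed.

End KacPetersonTheory.

Theorem lemma23 (R : realType) (Gamma : zmodType)
    (eps : commutation_factor R[i] Gamma) (g : zquadColorLie eps) :
  (exists! Psi : g -> g, is_PsiKP Psi) /\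
  forall Psi : g -> g, is_PsiKP Psi ->
    preserves_bigrading Psi /\
    (forall rho : {scalar g}, dual_degree 0 0 rho ->
      ((forall x y : g, psiKP x y = dform rho x y) <->
       (forall x : g, Psi x = brk (sharp rho) x))).
Proof.
split=> [|Psi PsiP].
  have [Psi PsiP] := PsiKP_exists g; exists Psi; split=> // Psi' [_ Psi'E].
  apply/funext => x; apply: qform_injl => y.
  by rewrite -Psi'E; case: PsiP => _ ->.
split=> [|rho [rhoP _]]; first exact: is_PsiKP_bigrading.
exact: is_PsiKP_coboundary.
Qed.
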